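(* There exists a graph that admits a planar storyplan but does not admit a planar geometric storyplan.
   Context: A storyplan of a graph $G$ on time steps $[\ell]=\{1,\dots,\ell\}$, $\ell\in\mathbb{N}$, is a pair $(A,\mathcal{D})$ where: $A$ assigns to each vertex $v$ a nonempty interval $A(v)=[s_v,e_v]\subseteq[\ell]$ of consecutive integers (the visible interval; $v$ is visible at each $t\in A(v)$); for every edge $uv$ of $G$ we have $A(u)\cap A(v)\neq\emptyset$; and $\mathcal{D}$ assigns to each vertex a point of the plane and to each edge a curve between the points of its endpoints (one fixed drawing of each vertex and edge, used in all time steps). For $t\in[\ell]$, the frame at $t$ is the drawing under $\mathcal{D}$ of the induced subgraph $G[\{v : t\in A(v)\}]$, and each frame must be a simple drawing. Several vertices may appear in the same time step. A storyplan is planar if every frame is a planar drawing (no crossings), and planar geometric if every frame is a planar drawing in which every edge is a straight-line segment. *)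

(* Defs.v *)
From Stdlib Require Import Reals.
Open Scope R_scope.

Definition simple_graph (n : nat) (adj : nat -> nat -> Prop) : Prop :=
  (forall u v, adj u v -> (u < n)%nat /\ (v < n)%nat) /\
  (forall u v, adj u v -> adj v u) /\
  (forall u, ~ adj u u).

Definition point := (R * R)%type.
Definition curve := R -> point.

Definition in01 (t : R) : Prop := 0 <= t <= 1.

(** A curve is parametrized on [0,1]; we require it continuous (w.l.o.g. on
    all of R, since any continuous map on [0,1] extends continuously). *)
Definition continuous_curve (c : curve) : Prop :=
  continuity (fun t => fst (c t)) /\ continuity (fun t => snd (c t)).

Definition visible (s e : nat -> nat) (v t : nat) : Prop :=
  (s v <= t <= e v)%nat.

Definition valid_intervals (n : nat) (adj : nat -> nat -> Prop) (l : nat)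
  (s e : nat -> nat) : Prop :=
  (forall v, (v < n)%nat -> (1 <= s v)%nat /\ (s v <= e v)%nat /\ (e v <= l)%nat) /\
  (forall u v, adj u v -> exists t, visible s e u t /\ visible s e v t).

(** A drawing D: vertex positions p and, for each edge uv, a curve gam u v
    from p u to p v (a Jordan arc); the curve of the same edge seen from the
    other endpoint is the reversed curve, so each edge has one drawing. *)
Definition drawing (adj : nat -> nat -> Prop) (p : nat -> point)
  (gam : nat -> nat -> curve) : Prop :=
  forall u v, adj u v ->
    continuous_curve (gam u v) /\
    gam u v 0 = p u /\ gam u v 1 = p v /\
    (forall t t', in01 t -> in01 t' -> gam u v t = gam u v t' -> t = t') /\
    (forall t, in01 t -> gam v u t = gam u v (1 - t)).

Definition planar_frame (n : nat) (adj : nat -> nat -> Prop) (s e : nat -> nat)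
  (p : nat -> point) (gam : nat -> nat -> curve) (t : nat) : Prop :=
  let V := fun v => (v < n)%nat /\ visible s e v t in
  (forall u v, V u -> V v -> u <> v -> p u <> p v) /\
  (forall u v w r, adj u v -> V u -> V v -> V w -> w <> u -> w <> v ->
     in01 r -> gam u v r <> p w) /\
  (forall u v x y r r', adj u v -> adj x y -> V u -> V v -> V x -> V y ->
     ~ ((u = x /\ v = y) \/ (u = y /\ v = x)) ->
     in01 r -> in01 r' -> gam u v r = gam x y r' ->
     exists z, (z = u \/ z = v) /\ (z = x \/ z = y) /\ gam u v r = p z).

Definition planar_storyplan (n : nat) (adj : nat -> nat -> Prop) (l : nat)
  (s e : nat -> nat) (p : nat -> point) (gam : nat -> nat -> curve) : Prop :=
  valid_intervals n adj l s e /\ drawing adj p gam /\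
  (forall t, (1 <= t <= l)%nat -> planar_frame n adj s e p gam t).

Definition straight_line (a b : point) : curve :=
  fun r => ((1 - r) * fst a + r * fst b, (1 - r) * snd a + r * snd b).

Definition has_planar_storyplan (n : nat) (adj : nat -> nat -> Prop) : Prop :=
  exists l s e p gam, planar_storyplan n adj l s e p gam.

Definition has_planar_geometric_storyplan (n : nat) (adj : nat -> nat -> Prop)
  : Prop :=
  exists l s e p gam, planar_storyplan n adj l s e p gam /\
    (forall u v, adj u v -> forall r, in01 r -> gam u v r = straight_line (p u) (p v) r).

(* Main.v *)
Require Import Defs.
From Stdlib Require Import Reals.
From Stdlib Require Import Lra Psatz Lia Arith List Bool ZArith.
Import ListNotations.
Open Scope R_scope.

(**
The graph has a triangle 0, 1, 2, three further vertices 3, 4, 5 and nine gadgets. A gadget consists of an apex, adjacent to 0, ..., 5, and three connectors. The apex and the triangle form a K4 with three faces (sectors) at the apex, and each connector ties one of 3, 4, 5 to one sector. The assignment of 3, 4, 5 to the sectors is rotated from one gadget to the next.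

Topologically the gadgets can be shown one after the other: draw one gadget with straight lines and apply powers of a twist of the plane that fixes the triangle and permutes 3, 4, 5 cyclically.

In a straight-line storyplan the vertices 0, ..., 5 share an interval of time that, for each of the three rotations, contains the whole life of some apex. If these three apexes lie inside the triangle, each of them separates, around the vertex 0, the two of 3, 4, 5 that its gadget puts into the sectors at 0; the three resulting comparisons of directions form a cycle. An apex outside the triangle lies in the cone opposite to a corner; three apexes in one cone give the same cycle around that corner, and other combinations contradict the signs of barycentric coordinates.
*)

(** * Straight-line drawings *)

Definition area (P Q T : point) : R :=
  (fst Q - fst P) * (snd T - snd P) - (snd Q - snd P) * (fst T - fst P).

Definition bary (X Y Z : point) (a b c : R) : point :=
  (a * fst X + b * fst Y + c * fst Z, a * snd X + b * snd Y + c * snd Z).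

Definition inside (X Y Z P : point) : Prop :=
  exists a b c, 0 < a /\ 0 < b /\ 0 < c /\ a + b + c = 1 /\ P = bary X Y Z a b c.

(** The region beyond the corner [X], between the extensions of the sides [Y X] and [Z X] past
    [X]. *)
Definition cone (X Y Z P : point) : Prop :=
  exists b c, 0 < b /\ 0 < c /\ P = bary X Y Z (1 + b + c) (- b) (- c).

Definition disjoint_segments (P Q S T : point) : Prop :=
  forall r r', in01 r -> in01 r' ->
    straight_line P Q r <> straight_line S T r'.

Definition off_segment (P Q T : point) : Prop :=
  forall r, in01 r -> straight_line P Q r <> T.

Lemma in01_frac (a b : R) : 0 <= a <= b -> 0 < b -> in01 (a / b).
Proof.
intros Ha Hb; split.
- apply Rmult_le_pos; [lra | left; now apply Rinv_0_lt_compat].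
- apply (Rmult_le_reg_r b); trivial.
  unfold Rdiv; rewrite Rmult_assoc, Rinv_l; lra.
Qed.

(** Both parameters are fractions over one denominator [d], so a crossing is exhibited by polynomial
    identities without division. *)
Lemma disjoint_segments_frac (P Q S T : point) (a b d : R) :
  disjoint_segments P Q S T -> 0 <= a <= d -> 0 <= b <= d -> 0 < d ->
  (d - a) * fst P + a * fst Q = (d - b) * fst S + b * fst T ->
  (d - a) * snd P + a * snd Q = (d - b) * snd S + b * snd T -> False.
Proof.
intros H Ha Hb Hd E1 E2.
apply (H (a / d) (b / d)); try now apply in01_frac.
unfold straight_line; f_equal; apply (Rmult_eq_reg_r d); try lra.
- transitivity ((d - a) * fst P + a * fst Q); [field; lra |].
  rewrite E1; field; lra.
- transitivity ((d - a) * snd P + a * snd Q); [field; lra |].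
  rewrite E2; field; lra.
Qed.

Lemma off_segment_frac (P Q T : point) (a d : R) :
  off_segment P Q T -> 0 <= a <= d -> 0 < d ->
  (d - a) * fst P + a * fst Q = d * fst T ->
  (d - a) * snd P + a * snd Q = d * snd T -> False.
Proof.
intros H Ha Hd E1 E2.
apply (H (a / d)); try now apply in01_frac.
rewrite (surjective_pairing T); unfold straight_line; f_equal; apply (Rmult_eq_reg_r d); try lra.
- transitivity ((d - a) * fst P + a * fst Q); [field; lra |]; lra.
- transitivity ((d - a) * snd P + a * snd Q); [field; lra |]; lra.
Qed.

(** If the area vanished, [Z] would be [X + t (Y - X)], and the position of [t] relative to 0 and 1
    would tell which point lies on the segment between the other two. *)
Lemma noncollinear (X Y Z : point) :
  X <> Y -> off_segment X Y Z -> off_segment X Z Y -> off_segment Y Z X ->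
  area X Y Z <> 0.
Proof.
destruct X as [x1 x2], Y as [y1 y2], Z as [z1 z2].
unfold area; simpl; intros Hxy HZ HY HX E.
assert (Ht : exists t, z1 - x1 = t * (y1 - x1) /\ z2 - x2 = t * (y2 - x2)).
{ destruct (Req_dec y1 x1) as [E1|N1].
  - destruct (Req_dec y2 x2) as [E2|N2]; [now subst |].
    exists ((z2 - x2) / (y2 - x2)); split; [| field; lra].
    apply (Rmult_eq_reg_r (y2 - x2)); [| lra].
    replace ((z2 - x2) / (y2 - x2) * (y1 - x1) * (y2 - x2))
      with ((z2 - x2) * (y1 - x1)) by (field; lra); lra.
  - exists ((z1 - x1) / (y1 - x1)); split; [field; lra |].
    apply (Rmult_eq_reg_r (y1 - x1)); [| lra].
    replace ((z1 - x1) / (y1 - x1) * (y2 - x2) * (y1 - x1))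
      with ((z1 - x1) * (y2 - x2)) by (field; lra); lra. }
destruct Ht as [t [H1 H2]].
assert (z1 = x1 + t * (y1 - x1)) by lra.
assert (z2 = x2 + t * (y2 - x2)) by lra.
subst; clear E H1 H2.
destruct (Rlt_le_dec t 0) as [T0|T0].
- apply (off_segment_frac _ _ _ 1 (1 - t) HX); simpl; try lra; ring.
- destruct (Rle_lt_dec t 1) as [T1|T1].
  + apply (off_segment_frac _ _ _ t 1 HZ); simpl; try lra; ring.
  + apply (off_segment_frac _ _ _ 1 t HY); simpl; try lra; ring.
Qed.

(** * Barycentric coordinates and the regions around a triangle *)

Lemma bary_area (X Y Z P : point) :
  area X Y Z <> 0 ->
  P = bary X Y Z (area Y Z P / area X Y Z) (area Z X P / area X Y Z)
        (area X Y P / area X Y Z).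
Proof.
intros H; rewrite (surjective_pairing P) at 1; unfold bary; f_equal;
  revert H; unfold area; intros H; field; trivial.
Qed.

Lemma area_bary1 (X Y Z : point) (a b c : R) :
  a + b + c = 1 -> area Y Z (bary X Y Z a b c) = a * area X Y Z.
Proof. intros H; replace a with (1 - b - c) by lra; unfold area, bary; simpl; ring. Qed.

Lemma area_bary2 (X Y Z : point) (a b c : R) :
  a + b + c = 1 -> area Z X (bary X Y Z a b c) = b * area X Y Z.
Proof. intros H; replace a with (1 - b - c) by lra; unfold area, bary; simpl; ring. Qed.

Lemma area_bary3 (X Y Z : point) (a b c : R) :
  a + b + c = 1 -> area X Y (bary X Y Z a b c) = c * area X Y Z.
Proof. intros H; replace a with (1 - b - c) by lra; unfold area, bary; simpl; ring. Qed.

Lemma inside_rot (X Y Z P : point) : inside X Y Z P -> inside Y Z X P.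
Proof.
intros (a & b & c & Ha & Hb & Hc & E & ->).
exists b, c, a; repeat split; try lra; unfold bary; f_equal; ring.
Qed.

Lemma cone_swap (X Y Z P : point) : cone X Y Z P -> cone X Z Y P.
Proof.
intros (b & c & Hb & Hc & ->).
exists c, b; repeat split; try lra; unfold bary; f_equal; ring.
Qed.

(** The coordinates are nonzero with sum 1. None negative gives [inside], two negative give a cone,
    and exactly one negative would put [P] behind a side that the segment to the opposite corner
    then crosses. *)
Lemma barycentric_signs (X Y Z P : point) :
  area X Y Z <> 0 -> area Y Z P <> 0 -> area Z X P <> 0 -> area X Y P <> 0 ->
  disjoint_segments X Y Z P -> disjoint_segments Y Z X P ->
  disjoint_segments Z X Y P ->
  inside X Y Z P \/ cone X Y Z P \/ cone Y Z X P \/ cone Z X Y P.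
Proof.
intros HD H1 H2 H3 D1 D2 D3.
pose proof (bary_area X Y Z P HD) as E.
assert (S : area Y Z P / area X Y Z + area Z X P / area X Y Z
            + area X Y P / area X Y Z = 1).
{ revert HD; unfold area; intros; field; trivial. }
assert (N : forall u, u <> 0 -> u / area X Y Z <> 0).
{ intros u Hu; apply Rmult_integral_contrapositive_currified; trivial.
  now apply Rinv_neq_0_compat. }
apply N in H1; apply N in H2; apply N in H3; clear N.
set (a := area Y Z P / area X Y Z) in *.
set (b := area Z X P / area X Y Z) in *.
set (c := area X Y P / area X Y Z) in *.
(* With only [w] negative, [u U + v V = P - w W]; division by [1 - w] turns this into a common point
   of [U V] and [W P]. *)
assert (C : forall U V W u v w,
   u + v + w = 1 -> 0 < u -> 0 < v -> w < 0 ->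
   P = bary U V W u v w -> disjoint_segments U V W P -> False).
{ intros U V W u v w T Hu Hv Hw -> D.
  apply (disjoint_segments_frac _ _ _ _ v 1 (1 - w) D); try lra;
  unfold bary; simpl; replace u with (1 - v - w) by lra; ring. }
clearbody a b c; subst P.
destruct (Rdichotomy _ _ H1) as [A|A], (Rdichotomy _ _ H2) as [B|B],
  (Rdichotomy _ _ H3) as [G|G]; try lra.
- right; right; right; exists (- a), (- b); repeat split; try lra.
  unfold bary; f_equal; replace c with (1 - a - b) by lra; ring.
- right; right; left; exists (- c), (- a); repeat split; try lra.
  unfold bary; f_equal; replace c with (1 - a - b) by lra; ring.
- exfalso; apply (C Y Z X b c a); try lra; trivial.
  unfold bary; f_equal; ring.
- right; left; exists (- b), (- c); repeat split; try lra.
  unfold bary; f_equal; replace c with (1 - a - b) by lra; ring.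
- exfalso; apply (C Z X Y c a b); try lra; trivial.
  unfold bary; f_equal; ring.
- exfalso; apply (C X Y Z a b c); try lra; trivial.
- left; exists a, b, c; repeat split; lra.
Qed.

(** * Crossings forced by two points joined to the corners of a triangle *)

(** At [Y] and at [Z] it is compared which of [A], [B] is seen closer to the direction of [X]. If
    the answers differ, two segments to [Y] and [Z] cross. If one point is closer at both, it lies
    in the triangle of the other point with [Y] and [Z], and one of its own segments crosses the
    segment from the other point to [X]. *)
Lemma cones_same (X Y Z A B : point) :
  disjoint_segments A Y B Z -> disjoint_segments A Z B Y ->
  disjoint_segments A Y B X -> disjoint_segments A Z B X ->
  disjoint_segments A X B Y -> disjoint_segments A X B Z ->
  cone X Y Z A -> cone X Y Z B -> False.
Proof.
intros AYBZ AZBY AYBX AZBX AXBY AXBZ (b & c & Hb & Hc & ->) (b' & c' & Hb' & Hc' & ->).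
assert (0 < b * c') by now apply Rmult_lt_0_compat.
assert (0 < b' * c) by now apply Rmult_lt_0_compat.
destruct (Rle_lt_dec (c * (1 + b')) (c' * (1 + b))) as [I|I],
  (Rle_lt_dec (b' * (1 + c)) (b * (1 + c'))) as [J|J].
- set (d := (1 + b) * (1 + c') - b' * c).
  apply (disjoint_segments_frac _ _ _ _ (d - (1 + b' + c')) (d - (1 + b + c)) d AYBZ);
    unfold d, bary; simpl; try lra; ring.
(* The order of the directions at [X] tells on which side of [B X] the point [A] lies. *)
- destruct (Rle_lt_dec (b * c') (b' * c)).
  + set (d := b' * (1 + c) - b * c').
    apply (disjoint_segments_frac _ _ _ _ (d - b') (d - b) d AZBX);
    unfold d, bary; simpl; try lra; ring.
  + set (d := c' * (1 + b) - c * b').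
    apply (disjoint_segments_frac _ _ _ _ (d - c') (d - c) d AYBX);
    unfold d, bary; simpl; try lra; ring.
- destruct (Rle_lt_dec (b' * c) (b * c')).
  + set (d := b * (1 + c') - b' * c).
    apply (disjoint_segments_frac _ _ _ _ (d - b') (d - b) d AXBZ);
    unfold d, bary; simpl; try lra; ring.
  + set (d := c * (1 + b') - c' * b).
    apply (disjoint_segments_frac _ _ _ _ (d - c') (d - c) d AXBY);
    unfold d, bary; simpl; try lra; ring.
- set (d := (1 + c) * (1 + b') - c' * b).
  apply (disjoint_segments_frac _ _ _ _ (d - (1 + b' + c')) (d - (1 + b + c)) d AZBY);
    unfold d, bary; simpl; try lra; ring.
Qed.

(** [A Y] and [B X] are the diagonals of a convex quadrilateral on the side of [X Y] away from
    [Z]. *)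
Lemma cones_different (X Y Z A B : point) :
  disjoint_segments A Y B X -> cone X Y Z A -> cone Y X Z B -> False.
Proof.
intros D (b & c & Hb & Hc & ->) (b' & c' & Hb' & Hc' & ->).
assert (0 < b * c') by now apply Rmult_lt_0_compat.
assert (0 < b' * c) by now apply Rmult_lt_0_compat.
assert (0 < c * c') by now apply Rmult_lt_0_compat.
set (d := c' * (1 + b + c) + c * (1 + b')).
apply (disjoint_segments_frac _ _ _ _ (d - c') (d - c) d D);
  unfold d, bary; simpl; try lra; ring.
Qed.

(** The two comparisons put [B] into the triangle [A Y Z], which [B X] has to leave through [A Y] or
    [A Z]; the order of the directions at [X] tells through which. *)
Lemma insides_sector (X Y Z A B : point) (a b c a' b' c' : R) :
  0 < a -> 0 < b -> 0 < c -> 0 < a' -> 0 < b' -> 0 < c' ->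
  a + b + c = 1 -> a' + b' + c' = 1 ->
  A = bary X Y Z a b c -> B = bary X Y Z a' b' c' ->
  a' * b <= a * b' -> a' * c <= a * c' ->
  disjoint_segments B X A Y -> disjoint_segments B X A Z -> False.
Proof.
intros Ha Hb Hc Ha' Hb' Hc' S S' -> -> I J DY DZ.
destruct (Rle_lt_dec (b * c') (b' * c)).
- set (d := c + c' * a - c * a').
  apply (disjoint_segments_frac _ _ _ _ (d - c) (d - c') d DY);
    unfold d, bary; simpl; replace b with (1 - a - c) in * by lra;
    replace b' with (1 - a' - c') in * by lra; try lra; ring.
- set (d := b + b' * a - b * a').
  apply (disjoint_segments_frac _ _ _ _ (d - b) (d - b') d DZ);
    unfold d, bary; simpl; replace c with (1 - a - b) in * by lra;
    replace c' with (1 - a' - b') in * by lra; try lra; ring.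
Qed.

Lemma disjoint_segments_sym (P Q S T : point) :
  disjoint_segments P Q S T -> disjoint_segments S T P Q.
Proof. intros H r r' Hr Hr' E; now apply (H r' r). Qed.

Lemma straight_line_rev (P Q : point) (r : R) :
  straight_line P Q r = straight_line Q P (1 - r).
Proof. unfold straight_line; f_equal; ring. Qed.


Lemma min3 (x y z : R) :
  (x <= y /\ x <= z) \/ (y <= z /\ y <= x) \/ (z <= x /\ z <= y).
Proof. lra. Qed.

(* A segment from a point inside leaves the triangle through the side for which the ratio of the barycentric coordinates of its ends is least. *)
Lemma leaves_inside_aux (X Y Z : point) (a b c r s t : R) :
  0 < a -> 0 < b -> 0 < c -> a + b + c = 1 -> r * a + s * b + t * c = 1 ->
  t <= r -> t <= s ->
  disjoint_segments (bary X Y Z a b c) (bary X Y Z (r * a) (s * b) (t * c)) X Y ->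
  0 < t.
Proof.
intros Ha Hb Hc S S' Hr Hs D.
destruct (Rlt_le_dec 0 t) as [P|N]; trivial; exfalso.
assert (0 <= (s - t) * b) by (apply Rmult_le_pos; lra).
assert (0 <= (r - t) * a) by (apply Rmult_le_pos; lra).
assert ((s - t) * b + (r - t) * a = 1 - t).
{ transitivity (1 - t * c - t * b - t * a); [lra |].
  replace a with (1 - b - c) by lra; ring. }
apply (disjoint_segments_frac _ _ _ _ 1 ((s - t) * b) (1 - t) D); try lra;
  unfold bary; simpl; replace (1 - t - (s - t) * b) with ((r - t) * a) by lra; ring.
Qed.

Lemma leaves_inside (X Y Z C H : point) :
  area X Y Z <> 0 ->
  disjoint_segments C H X Y -> disjoint_segments C H Y Z ->
  disjoint_segments C H Z X -> inside X Y Z C -> inside X Y Z H.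
Proof.
intros HD DZ DX DY (a & b & c & Ha & Hb & Hc & S & ->).
pose proof (bary_area X Y Z H HD) as E.
assert (S' : area Y Z H / area X Y Z + area Z X H / area X Y Z
            + area X Y H / area X Y Z = 1).
{ revert HD; unfold area; intros; field; trivial. }
assert (Q : forall u v, 0 < v -> exists r, u = r * v).
{ intros u v Hv; exists (u / v); field; lra. }
(* [r], [s], [t] are the ratios of the coordinates of [H] to those of [C]; it is enough that the
   least of them is positive. *)
destruct (Q (area Y Z H / area X Y Z) a Ha) as [r Er].
destruct (Q (area Z X H / area X Y Z) b Hb) as [s Es].
destruct (Q (area X Y H / area X Y Z) c Hc) as [t Et].
rewrite Er, Es, Et in *; clear Er Es Et Q; subst H.
assert (P : 0 < r /\ 0 < s /\ 0 < t).
{ assert (R1 : forall u v w, bary Y Z X v w u = bary X Y Z u v w)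
    by (intros; unfold bary; f_equal; ring).
  assert (R2 : forall u v w, bary Z X Y w u v = bary X Y Z u v w)
    by (intros; unfold bary; f_equal; ring).
  destruct (min3 r s t) as [[I J]|[[I J]|[I J]]].
  - assert (0 < r); [| lra].
    apply (leaves_inside_aux Y Z X b c a s t r); try lra; now rewrite !R1.
  - assert (0 < s); [| lra].
    apply (leaves_inside_aux Z X Y c a b t r s); try lra; now rewrite !R2.
  - assert (0 < t); [| lra].
    apply (leaves_inside_aux X Y Z a b c r s t); try lra; trivial. }
exists (r * a), (s * b), (t * c); repeat split; try lra;
  apply Rmult_lt_0_compat; lra.
Qed.

(** * Plane straight-line graphs with apexes over a triangle *)

(** A frame is given by its edges alone, so [psg_off] takes an edge [w w'] as witness that [w]
    belongs to the frame. *)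
Record plane_straight_graph (E : nat -> nat -> Prop) (p : nat -> point) : Prop := {
  psg_sym : forall u v, E u v -> E v u;
  psg_neq : forall u v, E u v -> p u <> p v;
  psg_off : forall u v w w', E u v -> E w w' -> w <> u -> w <> v ->
    off_segment (p u) (p v) (p w);
  psg_disjoint : forall u v w w', E u v -> E w w' ->
    u <> w -> u <> w' -> v <> w -> v <> w' ->
    disjoint_segments (p u) (p v) (p w) (p w') }.

Lemma psg_irrefl E p u v : plane_straight_graph E p -> E u v -> u <> v.
Proof. intros G H ->; now apply (psg_neq _ _ G v v H). Qed.

Lemma triangle_area E p x y z : plane_straight_graph E p ->
  E x y -> E y z -> E z x -> area (p x) (p y) (p z) <> 0.
Proof.
intros G Hxy Hyz Hzx.
pose proof (psg_irrefl _ _ _ _ G Hxy); pose proof (psg_irrefl _ _ _ _ G Hyz);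
pose proof (psg_irrefl _ _ _ _ G Hzx).
apply noncollinear.
- now apply (psg_neq _ _ G).
- apply (psg_off _ _ G _ _ _ x); auto.
- apply (psg_off _ _ G _ _ _ z); auto; now apply (psg_sym _ _ G).
- apply (psg_off _ _ G _ _ _ y); auto.
Qed.

Definition is_triangle (E : nat -> nat -> Prop) (x y z : nat) : Prop :=
  E x y /\ E y z /\ E z x.

Definition apex (E : nat -> nat -> Prop) (x y z a : nat) : Prop :=
  E a x /\ E a y /\ E a z.

Lemma apex_signs E p x y z a : plane_straight_graph E p ->
  is_triangle E x y z -> apex E x y z a ->
  inside (p x) (p y) (p z) (p a) \/ cone (p x) (p y) (p z) (p a)
  \/ cone (p y) (p z) (p x) (p a) \/ cone (p z) (p x) (p y) (p a).
Proof.
intros G (Hxy & Hyz & Hzx) (Hax & Hay & Haz).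
pose proof (psg_irrefl _ _ _ _ G Hxy); pose proof (psg_irrefl _ _ _ _ G Hyz);
pose proof (psg_irrefl _ _ _ _ G Hzx); pose proof (psg_irrefl _ _ _ _ G Hax);
pose proof (psg_irrefl _ _ _ _ G Hay); pose proof (psg_irrefl _ _ _ _ G Haz).
pose proof (psg_sym _ _ G _ _ Hax); pose proof (psg_sym _ _ G _ _ Hay);
pose proof (psg_sym _ _ G _ _ Haz).
apply barycentric_signs; try (now apply (triangle_area E p));
  apply (psg_disjoint _ _ G); auto.
Qed.

(** A triangle with two apexes is [K_5] minus an edge, and the triangle separates the apexes. If
    both were inside, the least ratio of coordinates would name the sector of [a] that contains [d];
    if both were outside, their cones, equal or different, would force a crossing. *)
Lemma apexes_opposite_sides E p x y z a d : plane_straight_graph E p ->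
  is_triangle E x y z -> apex E x y z a -> apex E x y z d -> a <> d ->
  (inside (p x) (p y) (p z) (p a) /\ ~ inside (p x) (p y) (p z) (p d)) \/
  (inside (p x) (p y) (p z) (p d) /\ ~ inside (p x) (p y) (p z) (p a)).
Proof.
intros G T A D Had.
pose proof (apex_signs E p x y z a G T A) as Sa.
pose proof (apex_signs E p x y z d G T D) as Sd.
destruct T as (Hxy & Hyz & Hzx), A as (Hax & Hay & Haz), D as (Hdx & Hdy & Hdz).
pose proof (psg_irrefl _ _ _ _ G Hxy); pose proof (psg_irrefl _ _ _ _ G Hyz);
pose proof (psg_irrefl _ _ _ _ G Hzx); pose proof (psg_irrefl _ _ _ _ G Hax);
pose proof (psg_irrefl _ _ _ _ G Hay); pose proof (psg_irrefl _ _ _ _ G Haz);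
pose proof (psg_irrefl _ _ _ _ G Hdx);
pose proof (psg_irrefl _ _ _ _ G Hdy); pose proof (psg_irrefl _ _ _ _ G Hdz).
pose proof (psg_disjoint _ _ G a x d y Hax Hdy) as DXY.
pose proof (psg_disjoint _ _ G a x d z Hax Hdz) as DXZ.
pose proof (psg_disjoint _ _ G a y d x Hay Hdx) as DYX.
pose proof (psg_disjoint _ _ G a y d z Hay Hdz) as DYZ.
pose proof (psg_disjoint _ _ G a z d x Haz Hdx) as DZX.
pose proof (psg_disjoint _ _ G a z d y Haz Hdy) as DZY.
specialize (DXY ltac:(auto) ltac:(auto) ltac:(auto) ltac:(auto)).
specialize (DXZ ltac:(auto) ltac:(auto) ltac:(auto) ltac:(auto)).
specialize (DYX ltac:(auto) ltac:(auto) ltac:(auto) ltac:(auto)).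
specialize (DYZ ltac:(auto) ltac:(auto) ltac:(auto) ltac:(auto)).
specialize (DZX ltac:(auto) ltac:(auto) ltac:(auto) ltac:(auto)).
specialize (DZY ltac:(auto) ltac:(auto) ltac:(auto) ltac:(auto)).
assert (I : ~ (inside (p x) (p y) (p z) (p a) /\ inside (p x) (p y) (p z) (p d))).
{ intros [(u & v & w & Hu & Hv & Hw & S & E1) (u' & v' & w' & Hu' & Hv' & Hw' & S' & E2)].
  assert (R1 : forall i j k, bary (p x) (p y) (p z) i j k = bary (p y) (p z) (p x) j k i)
    by (intros; unfold bary; f_equal; ring).
  assert (R2 : forall i j k, bary (p x) (p y) (p z) i j k = bary (p z) (p x) (p y) k i j)
    by (intros; unfold bary; f_equal; ring).
  assert (Q : forall i j, 0 < j -> exists r, i = r * j).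
  { intros i j Hj; exists (i / j); field; lra. }
  assert (M : forall i j k l, 0 < k -> 0 < l -> i <= j -> i * k * l <= k * (j * l)).
  { intros i j k l Hk Hl Hij; assert (0 <= (j - i) * (k * l)); [| lra].
    apply Rmult_le_pos; [lra | left; now apply Rmult_lt_0_compat]. }
  destruct (Q u' u Hu) as [r ->], (Q v' v Hv) as [s ->], (Q w' w Hw) as [t ->]; clear Q.
  destruct (min3 r s t) as [[J K]|[[J K]|[J K]]].
  - apply (insides_sector (p x) (p y) (p z) (p a) (p d) u v w (r * u) (s * v) (t * w));
    trivial; try (now apply disjoint_segments_sym); try lra; now apply M.
  - rewrite R1 in E1; rewrite R1 in E2.
    apply (insides_sector (p y) (p z) (p x) (p a) (p d) v w u (s * v) (t * w) (r * u));
    trivial; try (now apply disjoint_segments_sym); try lra; now apply M.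
  - rewrite R2 in E1; rewrite R2 in E2.
    apply (insides_sector (p z) (p x) (p y) (p a) (p d) w u v (t * w) (r * u) (s * v));
    trivial; try (now apply disjoint_segments_sym); try lra; now apply M. }
destruct Sa as [Sa|Sa]; [left; split; tauto |].
destruct Sd as [Sd|Sd]; [right; split; tauto |].
exfalso.
destruct Sa as [Sa|[Sa|Sa]], Sd as [Sd|[Sd|Sd]].
- now apply (cones_same (p x) (p y) (p z) (p a) (p d)).
- apply (cones_different (p x) (p y) (p z) (p a) (p d)); trivial; now apply cone_swap.
- apply (cones_different (p x) (p z) (p y) (p a) (p d)); trivial; now apply cone_swap.
- apply (cones_different (p y) (p x) (p z) (p a) (p d)); trivial; now apply cone_swap.
- now apply (cones_same (p y) (p z) (p x) (p a) (p d)).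
- apply (cones_different (p y) (p z) (p x) (p a) (p d)); trivial; now apply cone_swap.
- apply (cones_different (p z) (p x) (p y) (p a) (p d)); trivial; now apply cone_swap.
- apply (cones_different (p z) (p y) (p x) (p a) (p d)); trivial; now apply cone_swap.
- now apply (cones_same (p z) (p x) (p y) (p a) (p d)).
Qed.

Lemma neighbour_inside E p x y z c h : plane_straight_graph E p ->
  is_triangle E x y z -> E c h -> c <> x -> c <> y -> c <> z -> h <> x -> h <> y -> h <> z ->
  inside (p x) (p y) (p z) (p c) -> inside (p x) (p y) (p z) (p h).
Proof.
intros G (Hxy & Hyz & Hzx) Hch; intros.
apply (leaves_inside _ _ _ (p c)); trivial; try (now apply (triangle_area E p));
  apply (psg_disjoint _ _ G); auto.
Qed.

(** Two of the three would be on the same side of the triangle. *)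
Lemma no_three_apexes E p x y z a b c : plane_straight_graph E p ->
  is_triangle E x y z -> apex E x y z a -> apex E x y z b -> apex E x y z c ->
  a <> b -> a <> c -> b <> c -> False.
Proof.
intros G T A B C; intros.
pose proof (apexes_opposite_sides E p x y z a b G T A B).
pose proof (apexes_opposite_sides E p x y z a c G T A C).
pose proof (apexes_opposite_sides E p x y z b c G T B C).
tauto.
Qed.

(** The path [a], [h], [b] avoids the triangle, so both apexes would be on the same side of it. *)
Lemma no_two_apexes_with_neighbour E p x y z a b h : plane_straight_graph E p ->
  is_triangle E x y z -> apex E x y z a -> apex E x y z b -> E a h -> E b h ->
  a <> b -> h <> x -> h <> y -> h <> z -> False.
Proof.
intros G T A B Ha Hb; intros.
assert (N : forall u, apex E x y z u -> u <> x /\ u <> y /\ u <> z).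
{ intros u (Hx & Hy & Hz); repeat split; now apply (psg_irrefl E p). }
destruct (N a A) as (? & ? & ?), (N b B) as (? & ? & ?).
assert (W : forall u v, E u h -> E v h -> u <> x -> u <> y -> u <> z ->
  v <> x -> v <> y -> v <> z -> inside (p x) (p y) (p z) (p u) -> 
  inside (p x) (p y) (p z) (p v)).
{ intros u v Hu Hv; intros.
  apply (neighbour_inside E p x y z h); auto; [now apply (psg_sym _ _ G) |].
  now apply (neighbour_inside E p x y z u). }
pose proof (W a b); pose proof (W b a).
destruct (apexes_opposite_sides E p x y z a b G T A B); tauto.
Qed.

(** Both [c] and [z] are apexes over the triangle [x], [y], [a], so exactly one is inside it. If it
    is [c], its neighbour [h] is inside too; if it is [z], then [a] lies beyond [z]. *)
Lemma sector E p x y z a c h : plane_straight_graph E p ->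
  is_triangle E x y z -> apex E x y z a -> apex E x y a c -> E c h ->
  c <> z -> h <> x -> h <> y -> h <> a ->
  cone (p z) (p x) (p y) (p a) \/ inside (p x) (p y) (p a) (p h).
Proof.
intros G (Hxy & Hyz & Hzx) (Hax & Hay & Haz) C Hch Hcz; intros.
assert (Ta : is_triangle E x y a).
{ repeat split; trivial; now apply (psg_sym _ _ G). }
assert (Z : apex E x y a z).
{ repeat split; trivial; now apply (psg_sym _ _ G). }
destruct (apexes_opposite_sides E p x y a c z G Ta C Z Hcz) as [[I _]|[I _]].
- right; destruct C as (Hcx & Hcy & Hca).
  apply (neighbour_inside E p x y a c); trivial; now apply (psg_irrefl E p).
- left; destruct I as (l & m & n & Hl & Hm & Hn & S & Ez).
  assert (0 < l / n) by now apply Rdiv_lt_0_compat.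
  assert (0 < m / n) by now apply Rdiv_lt_0_compat.
  (* This solves [z = l x + m y + n a] for [a]; the coefficient of [z] is
     [1 / n = 1 + l / n + m / n]. *)
  exists (l / n), (m / n); repeat split; trivial.
  rewrite Ez, (surjective_pairing (p a)); unfold bary; simpl.
  replace l with (1 - m - n) by lra; f_equal; field; lra.
Qed.

(** * Signs and slopes of three rotated gadgets *)

(** The slopes [x / y] would increase strictly along a cycle. *)
Lemma no_slope_cycle (x0 y0 x1 y1 x2 y2 : R) :
  0 < y0 -> 0 < y1 -> 0 < y2 ->
  x0 * y1 < x1 * y0 -> x1 * y2 < x2 * y1 -> x2 * y0 < x0 * y2 -> False.
Proof.
intros H0 H1 H2 A B C.
apply (Rmult_lt_compat_r y2) in A; trivial.
apply (Rmult_lt_compat_r y0) in B; trivial.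
apply (Rmult_lt_compat_r y1) in C; trivial.
lra.
Qed.

Lemma no_slope_cycle_neg (x0 y0 x1 y1 x2 y2 : R) :
  y0 < 0 -> y1 < 0 -> y2 < 0 ->
  x0 * y1 < x1 * y0 -> x1 * y2 < x2 * y1 -> x2 * y0 < x0 * y2 -> False.
Proof.
intros; apply (no_slope_cycle (- x0) (- y0) (- x1) (- y1) (- x2) (- y2)); lra.
Qed.

(* A sector of the star of [A] is recorded only if it is a bounded triangle: it is the outer region when [A] lies in the cone at the opposite corner. *)
Definition gadget_at (X Y Z A P Q R : point) : Prop :=
  (inside X Y Z A \/ cone X Y Z A \/ cone Y Z X A \/ cone Z X Y A) /\
  (cone X Y Z A \/ inside Y Z A P) /\
  (cone Y Z X A \/ inside Z X A Q) /\
  (cone Z X Y A \/ inside X Y A R).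

(** The barycentric coordinate at the first corner; rotating the corners gives the other two. *)
Definition coord (X Y Z P : point) : R := area Y Z P / area X Y Z.

Lemma area_rot (X Y Z : point) : area Y Z X = area X Y Z.
Proof. unfold area; ring. Qed.

Lemma coord_inside (X Y Z P : point) :
  area X Y Z <> 0 -> inside X Y Z P -> 0 < coord X Y Z P.
Proof.
intros HD (a & b & c & Ha & Hb & Hc & S & ->).
unfold coord; rewrite area_bary1 by trivial.
replace (a * area X Y Z / area X Y Z) with a by (field; trivial); trivial.
Qed.

Lemma coord_cone (X Y Z P : point) :
  area X Y Z <> 0 -> cone X Y Z P ->
  0 < coord X Y Z P /\ coord Y Z X P < 0 /\ coord Z X Y P < 0.
Proof.
intros HD (b & c & Hb & Hc & ->).
unfold coord; rewrite area_bary1, area_bary2, area_bary3 by ring.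
rewrite <- (area_rot X Y Z), <- (area_rot Y Z X) in *.
repeat split.
- replace ((1 + b + c) * area Z X Y / area Z X Y) with (1 + b + c) by (field; trivial); lra.
- replace (- b * area Z X Y / area Z X Y) with (- b) by (field; trivial); lra.
- replace (- c * area Z X Y / area Z X Y) with (- c) by (field; trivial); lra.
Qed.

(** From [P = l X + m Y + n A]: the coordinate at [Z] comes from [A] alone and so keeps its sign. *)
Lemma coord_sector (X Y Z A P : point) :
  area X Y Z <> 0 -> inside X Y A P ->
  exists l m n, 0 < l /\ 0 < m /\ 0 < n /\
    coord X Y Z P = l + n * coord X Y Z A /\
    coord Y Z X P = m + n * coord Y Z X A /\
    coord Z X Y P = n * coord Z X Y A.
Proof.
intros HD (l & m & n & Hl & Hm & Hn & S & ->).
exists l, m, n; repeat split; trivial; unfold coord;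
  [| rewrite (area_rot X Y Z) | rewrite (area_rot Y Z X), (area_rot X Y Z)];
  apply (Rmult_eq_reg_r (area X Y Z)); trivial;
  field_simplify; trivial; replace l with (1 - m - n) by lra; unfold area, bary; simpl; ring.
Qed.

Lemma mult_lt_neg (a b c d : R) : a < b -> b < 0 -> c < d -> d < 0 -> b * d < a * c.
Proof.
intros; assert (0 < (b - a) * - d) by (apply Rmult_lt_0_compat; lra).
assert (0 < - a * (d - c)) by (apply Rmult_lt_0_compat; lra); lra.
Qed.

Lemma mult_lt_pos (a b c d : R) : a < b -> 0 < a -> c < d -> 0 < c -> a * c < b * d.
Proof. intros; apply Rmult_le_0_lt_compat; lra. Qed.

(** At a corner, the ratio of the other two coordinates of [A] separates the points placed in the
    two sectors there. In a cone this compares slopes at its corner once both points have two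
    negative coordinates, hence the premises. The last three alternatives are rotations of each
    other. *)
Lemma gadget_signs (X Y Z A P Q R : point) :
  area X Y Z <> 0 -> gadget_at X Y Z A P Q R ->
  let x := coord X Y Z in let y := coord Y Z X in let z := coord Z X Y in
  (0 < x P /\ 0 < x Q /\ 0 < x R /\ 0 < y P /\ 0 < y Q /\ 0 < y R /\
   0 < z P /\ 0 < z Q /\ 0 < z R /\ y Q * z R < y R * z Q) \/
  (y Q < 0 /\ z R < 0 /\ 0 < x Q /\ 0 < x R /\
   (z Q < 0 -> y R < 0 -> y R * z Q < y Q * z R)) \/
  (z R < 0 /\ x P < 0 /\ 0 < y R /\ 0 < y P /\
   (x R < 0 -> z P < 0 -> z P * x R < z R * x P)) \/
  (x P < 0 /\ y Q < 0 /\ 0 < z P /\ 0 < z Q /\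
   (y P < 0 -> x Q < 0 -> x Q * y P < x P * y Q)).
Proof.
intros HD (HA & HP & HQ & HR) x y z.
assert (HD1 : area Y Z X <> 0) by now rewrite area_rot.
assert (HD2 : area Z X Y <> 0) by now rewrite 2 area_rot.
assert (CX : cone X Y Z A -> 0 < x A /\ y A < 0 /\ z A < 0) by now apply coord_cone.
assert (CY : cone Y Z X A -> 0 < y A /\ z A < 0 /\ x A < 0) by now apply coord_cone.
assert (CZ : cone Z X Y A -> 0 < z A /\ x A < 0 /\ y A < 0) by now apply coord_cone.
assert (KP : 0 < z A \/ 0 < y A -> exists l m n, 0 < l /\ 0 < m /\ 0 < n /\
   y P = l + n * y A /\ z P = m + n * z A /\ x P = n * x A).
{ intros N; destruct HP as [HP|HP]; [specialize (CX HP); lra |].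
  now apply coord_sector. }
assert (KQ : 0 < x A \/ 0 < z A -> exists l m n, 0 < l /\ 0 < m /\ 0 < n /\
   z Q = l + n * z A /\ x Q = m + n * x A /\ y Q = n * y A).
{ intros N; destruct HQ as [HQ|HQ]; [specialize (CY HQ); lra |].
  now apply coord_sector. }
assert (KR : 0 < x A \/ 0 < y A -> exists l m n, 0 < l /\ 0 < m /\ 0 < n /\
   x R = l + n * x A /\ y R = m + n * y A /\ z R = n * z A).
{ intros N; destruct HR as [HR|HR]; [specialize (CZ HR); lra |].
  now apply coord_sector. }
assert (PP : forall n u, 0 < n -> 0 < u -> 0 < n * u)
  by (intros; now apply Rmult_lt_0_compat).
assert (PN : forall n u, 0 < n -> u < 0 -> n * u < 0).
{ intros n u Hn Hu; assert (0 < n * - u) by (apply PP; lra); lra. }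
destruct HA as [HA|[HA|[HA|HA]]].
- left.
  assert (xA : 0 < x A) by now apply coord_inside.
  assert (yA : 0 < y A) by (apply coord_inside; trivial; now apply inside_rot).
  assert (zA : 0 < z A)
    by (apply coord_inside; trivial; now apply inside_rot, inside_rot).
  destruct KP as (l1 & m1 & n1 & ? & ? & ? & -> & -> & ->); [tauto |].
  destruct KQ as (l2 & m2 & n2 & ? & ? & ? & -> & -> & ->); [tauto |].
  destruct KR as (l3 & m3 & n3 & ? & ? & ? & -> & -> & ->); [tauto |].
  pose proof (PP n1 (x A)); pose proof (PP n1 (y A)); pose proof (PP n1 (z A)).
  pose proof (PP n2 (x A)); pose proof (PP n2 (y A)); pose proof (PP n2 (z A)).
  pose proof (PP n3 (x A)); pose proof (PP n3 (y A)); pose proof (PP n3 (z A)).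
  repeat split; try lra.
  (* After regrouping, the factors compare one by one: the [y] of [R] exceeds [n3 * y A], and the
     [z] of [Q] exceeds [n2 * z A]. *)
  replace (n2 * y A * (n3 * z A)) with (n3 * y A * (n2 * z A)) by ring.
  apply mult_lt_pos; lra.
- right; left; clear KP; destruct (CX HA) as (xA & yA & zA).
  destruct KQ as (l2 & m2 & n2 & ? & ? & ? & -> & -> & ->); [tauto |].
  destruct KR as (l3 & m3 & n3 & ? & ? & ? & -> & -> & ->); [tauto |].
  pose proof (PP n2 (x A)); pose proof (PN n2 (y A)); pose proof (PN n2 (z A)).
  pose proof (PP n3 (x A)); pose proof (PN n3 (y A)); pose proof (PN n3 (z A)).
  repeat split; try lra; intros.
  replace (n2 * y A * (n3 * z A)) with (n3 * y A * (n2 * z A)) by ring.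
  apply mult_lt_neg; lra.
- right; right; left; clear KQ; destruct (CY HA) as (yA & zA & xA).
  destruct KP as (l2 & m2 & n2 & ? & ? & ? & -> & -> & ->); [tauto |].
  destruct KR as (l3 & m3 & n3 & ? & ? & ? & -> & -> & ->); [tauto |].
  pose proof (PN n2 (x A)); pose proof (PP n2 (y A)); pose proof (PN n2 (z A)).
  pose proof (PN n3 (x A)); pose proof (PP n3 (y A)); pose proof (PN n3 (z A)).
  repeat split; try lra; intros.
  replace (n3 * z A * (n2 * x A)) with (n2 * z A * (n3 * x A)) by ring.
  apply mult_lt_neg; lra.
- right; right; right; clear KR; destruct (CZ HA) as (zA & xA & yA).
  destruct KP as (l2 & m2 & n2 & ? & ? & ? & -> & -> & ->); [tauto |].
  destruct KQ as (l3 & m3 & n3 & ? & ? & ? & -> & -> & ->); [tauto |].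
  pose proof (PN n2 (x A)); pose proof (PN n2 (y A)); pose proof (PP n2 (z A)).
  pose proof (PN n3 (x A)); pose proof (PN n3 (y A)); pose proof (PP n3 (z A)).
  repeat split; try lra; intros.
  replace (n2 * x A * (n3 * y A)) with (n3 * x A * (n2 * y A)) by ring.
  apply mult_lt_neg; lra.
Qed.

(** Apexes in different regions disagree about the sign of some coordinate. In a common cone, the
    signs forced by the three gadgets together supply the premises of all three slope
    comparisons. *)
Lemma no_rotated_gadgets (X Y Z A0 A1 A2 H0 H1 H2 : point) :
  area X Y Z <> 0 ->
  gadget_at X Y Z A0 H0 H1 H2 -> gadget_at X Y Z A1 H1 H2 H0 ->
  gadget_at X Y Z A2 H2 H0 H1 -> False.
Proof.
intros HD G0 G1 G2.
apply gadget_signs in G0, G1, G2; trivial; simpl in G0, G1, G2.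
set (x := coord X Y Z) in *; set (y := coord Y Z X) in *; set (z := coord Z X Y) in *.
clearbody x y z.
destruct G0 as [G0|[G0|[G0|G0]]]; destruct G1 as [G1|[G1|[G1|G1]]];
  try (exfalso; lra); destruct G2 as [G2|[G2|[G2|G2]]]; try (exfalso; lra).
- apply (no_slope_cycle (y H1) (z H1) (y H2) (z H2) (y H0) (z H0)); lra.
- apply (no_slope_cycle_neg (y H2) (z H2) (y H1) (z H1) (y H0) (z H0)); lra.
- apply (no_slope_cycle_neg (z H2) (x H2) (z H1) (x H1) (z H0) (x H0)); lra.
- apply (no_slope_cycle_neg (x H2) (y H2) (x H1) (y H1) (x H0) (y H0)); lra.
Qed.

(** * The graph and its straight-line storyplans *)

Open Scope nat_scope.

(* Roles in a gadget: 0, 1, 2 are the corners, 6 is the apex, and 7 + k is the connector attaching the vertex in role 3 + k to the sector opposite to corner k. [vertex g] maps roles to vertices; gadgets with the same [g mod 3] are copies of each other. *)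
Definition template_edges : list (nat * nat) :=
  [(0,1); (1,2); (2,0);
   (6,0); (6,1); (6,2); (6,3); (6,4); (6,5); (6,7); (6,8); (6,9);
   (7,1); (7,2); (7,3); (8,2); (8,0); (8,4); (9,0); (9,1); (9,5)].

Definition template_adj (i j : nat) : bool :=
  existsb (fun e => (i =? fst e) && (j =? snd e) || (i =? snd e) && (j =? fst e))
    template_edges.

Definition vertex (g i : nat) : nat :=
  if (i <? 3) then i
  else if (i <? 6) then 3 + (i + g) mod 3
  else 4 * g + i.

(** Finite facts are proved by running this function; [if] instead of [&&] spares inner searches
    under call-by-value evaluation. *)
Definition adjb (u v : nat) : bool :=
  existsb (fun g => existsb (fun i =>
    if u =? vertex g i
    then existsb (fun j => if v =? vertex g j then template_adj i j else false) (seq 0 10)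
    else false) (seq 0 10)) (seq 0 9).

Definition adj (u v : nat) : Prop := adjb u v = true.

(** This turns a check done by evaluation into a bounded universal statement. *)
Lemma forallb_lt (n : nat) (f : nat -> bool) :
  forallb f (seq 0 n) = true -> forall k, (k < n) -> f k = true.
Proof.
intros H k Hk; apply (proj1 (forallb_forall _ _) H), in_seq; lia.
Qed.

Lemma adjP (u v : nat) : adj u v <-> exists g i j,
  (g < 9) /\ (i < 10) /\ (j < 10) /\
  u = vertex g i /\ v = vertex g j /\ template_adj i j = true.
Proof.
unfold adj, adjb; split.
- rewrite existsb_exists; intros (g & Hg & H).
  rewrite existsb_exists in H; destruct H as (i & Hi & H).
  destruct (Nat.eqb_spec u (vertex g i)) as [Hu|]; [| discriminate].
  rewrite existsb_exists in H; destruct H as (j & Hj & H).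
  destruct (Nat.eqb_spec v (vertex g j)) as [Hv|]; [| discriminate].
  apply in_seq in Hg, Hi, Hj.
  exists g, i, j; repeat split; trivial; lia.
- intros (g & i & j & Hg & Hi & Hj & -> & -> & H).
  apply existsb_exists; exists g; split; [apply in_seq; lia |].
  apply existsb_exists; exists i; split; [apply in_seq; lia |].
  rewrite Nat.eqb_refl; apply existsb_exists; exists j; split; [apply in_seq; lia |].
  now rewrite Nat.eqb_refl.
Qed.

Lemma template_adj_sym (i j : nat) : template_adj i j = template_adj j i.
Proof.
unfold template_adj; induction template_edges as [|e l IH]; trivial.
simpl; rewrite IH; f_equal; rewrite orb_comm; f_equal; apply andb_comm.
Qed.

Lemma adj_sym (u v : nat) : adj u v -> adj v u.
Proof.
rewrite !adjP; intros (g & i & j & ? & ? & ? & ? & ? & H).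
exists g, j, i; rewrite template_adj_sym; now repeat split.
Qed.

Lemma vertex_lt (g i : nat) : (g < 9) -> (i < 10) -> (vertex g i < 42).
Proof.
unfold vertex; intros Hg Hi.
pose proof (Nat.mod_upper_bound (i + g) 3).
destruct (i <? 3) eqn:A; [| destruct (i <? 6) eqn:B];
rewrite ?Nat.ltb_lt, ?Nat.ltb_ge in *; lia.
Qed.

Lemma adj_lt (u v : nat) : adj u v -> (u < 42) /\ (v < 42).
Proof.
rewrite adjP; intros (g & i & j & Hg & Hi & Hj & -> & -> & _).
now split; apply vertex_lt.
Qed.

Lemma adj_irrefl (u : nat) : ~ adj u u.
Proof.
assert (H : forallb (fun u => negb (adjb u u)) (seq 0 42) = true) by (vm_compute; trivial).
intros E; destruct (adj_lt _ _ E) as [Hu _].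
apply (forallb_lt _ _ H) in Hu; unfold adj in E; now rewrite E in Hu.
Qed.

Lemma adj_simple : simple_graph 42 adj.
Proof. split; [apply adj_lt | split; [apply adj_sym | apply adj_irrefl]]. Qed.

Lemma gadget_adj (g i j : nat) : (g < 9) -> (i < 10) -> (j < 10) ->
  template_adj i j = true -> adj (vertex g i) (vertex g j).
Proof. intros; apply adjP; exists g, i, j; now repeat split. Qed.

Lemma apex_adj (g v : nat) : (g < 9) -> (v < 6) -> adj (4 * g + 6) v.
Proof.
assert (H : forallb (fun g => forallb (fun v => adjb (4 * g + 6) v) (seq 0 6)) (seq 0 9)
   = true) by (vm_compute; trivial).
intros Hg Hv; apply (forallb_lt _ _ H) in Hg; now apply (forallb_lt _ _ Hg) in Hv.
Qed.

(** * Straight-line storyplans: frames and time intervals *)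

Definition straight_plan (l : nat) (s e : nat -> nat) (p : nat -> point)
  (gam : nat -> nat -> curve) : Prop :=
  planar_storyplan 42 adj l s e p gam /\
  forall u v, adj u v -> forall r, in01 r -> gam u v r = straight_line (p u) (p v) r.

Definition frame (s e : nat -> nat) (t u v : nat) : Prop :=
  adj u v /\ visible s e u t /\ visible s e v t.

Lemma frame_straight l s e p gam t :
  straight_plan l s e p gam -> plane_straight_graph (frame s e t) p.
Proof.
intros [plan straight].
assert (P : forall u, (u < 42) -> visible s e u t -> planar_frame 42 adj s e p gam t).
{ intros u Hu Ht; apply plan; destruct plan as [[I _] _]; specialize (I u Hu).
  unfold visible in Ht; lia. }
split.
- intros u v (A & B & C); repeat split; try apply B; try apply C; now apply adj_sym.
- intros u v (A & B & C); destruct (adj_lt _ _ A) as [Hu Hv].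
  destruct (P u Hu B) as [D _]; apply D; try (split; assumption).
  intros ->; now apply (adj_irrefl v).
- intros u v w w' (A & B & C) (A' & B' & _) N1 N2 r Hr.
  destruct (adj_lt _ _ A) as [Hu Hv]; destruct (adj_lt _ _ A') as [Hw _].
  destruct (P u Hu B) as [_ [D _]].
  rewrite <- straight by trivial; apply D; trivial; now split.
- intros u v w w' (A & B & C) (A' & B' & C') N1 N2 N3 N4 r r' Hr Hr' E.
  destruct (adj_lt _ _ A) as [Hu Hv]; destruct (adj_lt _ _ A') as [Hw Hw'].
  destruct (P u Hu B) as [_ [_ D]].
  rewrite <- !straight in E by trivial.
  destruct (D u v w w' r r') as (x & [?|?] & [?|?] & _); trivial; try (split; assumption);
    try congruence.
  intros [[? ?]|[? ?]]; congruence.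
Qed.

(** One half of the overlap of two intervals; the reversed edge gives the other half. *)
Lemma adj_overlap l s e p gam u v :
  straight_plan l s e p gam -> adj u v -> (s u <= e v).
Proof.
intros [[[_ I] _] _] A; destruct (I u v A) as (t & ? & ?); unfold visible in *; lia.
Qed.

Lemma corners_adj u v : (u < 3) -> (v < 3) -> u <> v -> adj u v.
Proof.
intros Hu Hv N; destruct u as [|[|[|u]]]; try lia; destruct v as [|[|[|v]]]; try lia;
  now vm_compute.
Qed.

Lemma corner_triangle s e t :
  (forall i, (i < 3) -> visible s e i t) -> is_triangle (frame s e t) 0 1 2.
Proof. intros V; repeat split; try apply V; auto; apply corners_adj; lia. Qed.

Lemma apex_in_frame s e t g : (g < 9) -> visible s e (4 * g + 6) t ->
  (forall i, (i < 3) -> visible s e i t) -> apex (frame s e t) 0 1 2 (4 * g + 6).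
Proof.
intros Hg Ha V; split; [| split]; (split; [apply apex_adj; lia | split]); trivial;
  apply V; lia.
Qed.

(* If two of the vertices 0, ..., 5 were never visible together, all the apexes, being adjacent to both, would be visible throughout the gap, and by Helly also together with the three corners. *)
Lemma persistent_overlap l s e p gam u v : straight_plan l s e p gam ->
  (u < 6) -> (v < 6) -> (s u <= e v).
Proof.
intros P Hu Hv; destruct (le_lt_dec (s u) (e v)) as [|N]; trivial; exfalso.
assert (A : forall g w, (g < 9) -> (w < 6) ->
  (s (4 * g + 6) <= e w /\ s w <= e (4 * g + 6))).
{ intros g w Hg Hw; split; apply (adj_overlap l s e p gam); trivial; [| apply adj_sym];
  now apply apex_adj. }
assert (C : forall i j, (i < 3) -> (j < 3) -> (s i <= e j)).
{ intros i j Hi Hj; destruct (Nat.eq_dec i j) as [->|M].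
  - destruct P as [[[I _] _] _]; apply I; lia.
  - apply (adj_overlap l s e p gam); trivial; now apply corners_adj. }
(* The latest start among three corners and three apexes: intervals that overlap pairwise all
   contain it. *)
set (t := Nat.max (Nat.max (s 0) (Nat.max (s 1) (s 2)))
  (Nat.max (s (4 * 0 + 6)) (Nat.max (s (4 * 1 + 6)) (s (4 * 2 + 6))))).
assert (VC : forall i, (i < 3) -> visible s e i t).
{ intros i Hi; unfold t; split.
  - destruct i as [|[|[|i]]]; lia.
  - repeat apply Nat.max_lub; try (apply C; lia); apply A; lia. }
assert (VA : forall g, (g < 3) -> visible s e (4 * g + 6) t).
{ intros g Hg; unfold t; split.
  - destruct g as [|[|[|g]]]; lia.
  (* Any two apexes overlap: one starts by [e v], and the other lasts until [s u], which is
     later. *)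
  - assert (forall g', (g' < 9) -> (s (4 * g' + 6) <= e (4 * g + 6))).
    { intros g' Hg'; destruct (A g' v Hg' Hv), (A g u ltac:(lia) Hu); lia. }
    repeat apply Nat.max_lub; try (apply A; lia); auto with arith. }
apply (no_three_apexes (frame s e t) p 0 1 2 (4 * 0 + 6) (4 * 1 + 6) (4 * 2 + 6));
  try lia.
- now apply (frame_straight l s e p gam).
- now apply corner_triangle.
- apply apex_in_frame; trivial; [lia | apply VA; lia].
- apply apex_in_frame; trivial; [lia | apply VA; lia].
- apply apex_in_frame; trivial; [lia | apply VA; lia].
Qed.

Lemma argmax (f : nat -> nat) (n : nat) :
  exists u, (u < S n) /\ forall v, (v < S n) -> (f v <= f u).
Proof.
induction n as [|n (u & Hu & M)].
- exists 0%nat; split; [lia | intros v Hv; replace v with 0%nat by lia; lia].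
- destruct (le_lt_dec (f u) (f (S n))); [exists (S n) | exists u]; (split; [lia |]);
    intros v Hv; (destruct (Nat.eq_dec v (S n)) as [->|]; [lia |]);
    specialize (M v ltac:(lia)); lia.
Qed.

Lemma argmin (f : nat -> nat) (n : nat) :
  exists u, (u < S n) /\ forall v, (v < S n) -> (f u <= f v).
Proof.
induction n as [|n (u & Hu & M)].
- exists 0%nat; split; [lia | intros v Hv; replace v with 0%nat by lia; lia].
- destruct (le_lt_dec (f u) (f (S n))); [exists u | exists (S n)]; (split; [lia |]);
    intros v Hv; (destruct (Nat.eq_dec v (S n)) as [->|]; [lia |]);
    specialize (M v ltac:(lia)); lia.
Qed.

(** Vertex [3] serves as the common neighbour off the triangle. *)
Lemma no_two_apexes_with_persistent l s e p gam g g' t : straight_plan l s e p gam ->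
  (g < 9) -> (g' < 9) -> g <> g' -> (forall v, (v < 6) -> visible s e v t) ->
  visible s e (4 * g + 6) t -> visible s e (4 * g' + 6) t -> False.
Proof.
intros P Hg Hg' N V A A'.
assert (VC : forall i, (i < 3) -> visible s e i t) by (intros; apply V; lia).
apply (no_two_apexes_with_neighbour (frame s e t) p 0 1 2 (4 * g + 6) (4 * g' + 6) 3);
  try lia.
- now apply (frame_straight l s e p gam).
- now apply corner_triangle.
- now apply apex_in_frame.
- now apply apex_in_frame.
- split; [apply apex_adj; lia | split; trivial; apply V; lia].
- split; [apply apex_adj; lia | split; trivial; apply V; lia].
Qed.

(* An apex whose interval leaves the common interval of 0, ..., 5 contains one of its two ends, and each end belongs to at most one apex; so one of three copies stays inside. *)
Lemma surrounded_gadget l s e p gam k : straight_plan l s e p gam -> (k < 3) ->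
  exists g, (g < 9) /\ g mod 3 = k /\
    forall t, visible s e (4 * g + 6) t -> forall v, (v < 6) -> visible s e v t.
Proof.
intros P Hk.
destruct (argmax s 5) as (u & Hu & Mu), (argmin e 5) as (w & Hw & Mw).
assert (O : (s u <= e w)) by now apply (persistent_overlap l s e p gam).
assert (V : forall t, (s u <= t <= e w) -> forall v, (v < 6) -> visible s e v t).
{ intros t Ht v Hv; specialize (Mu v Hv); specialize (Mw v Hv); unfold visible; lia. }
(* Being adjacent to [w] and [u], the apex starts by [e w] and lasts until [s u]; if it starts
   before [s u] or ends after [e w], it covers that end. *)
assert (D : forall g, (g < 9) ->
  (forall t, visible s e (4 * g + 6) t -> forall v, (v < 6) -> visible s e v t) \/
  visible s e (4 * g + 6) (s u) \/ visible s e (4 * g + 6) (e w)).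
{ intros g Hg.
  pose proof (adj_overlap l s e p gam _ _ P (apex_adj g w Hg Hw)).
  pose proof (adj_overlap l s e p gam _ _ P (adj_sym _ _ (apex_adj g u Hg Hu))).
  unfold visible at 3 4.
  destruct (le_lt_dec (s u) (s (4 * g + 6))); [| right; left; lia].
  destruct (le_lt_dec (e (4 * g + 6)) (e w)); [| right; right; lia].
  left; intros t Ht; apply V; unfold visible in Ht; lia. }
assert (T : forall g g' t, (g < 9) -> (g' < 9) -> g <> g' ->
   (t = s u \/ t = e w) -> visible s e (4 * g + 6) t -> visible s e (4 * g' + 6) t -> False).
{ intros g g' t Hg Hg' N Ht; apply (no_two_apexes_with_persistent l s e p gam); trivial.
  apply V; lia. }
(* The three copies are the gadgets [k], [k + 3] and [k + 6]. *)
assert (R : forall j, (j < 3) -> (k + j * 3) mod 3 = k).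
{ intros j _; rewrite Nat.Div0.mod_add; now apply Nat.mod_small. }
destruct (D (k + 0 * 3) ltac:(lia)) as [D0|D0]; [exists (k + 0 * 3) |].
{ split; [lia | split; trivial; apply R; lia]. }
destruct (D (k + 1 * 3) ltac:(lia)) as [D1|D1]; [exists (k + 1 * 3) |].
{ split; [lia | split; trivial; apply R; lia]. }
destruct (D (k + 2 * 3) ltac:(lia)) as [D2|D2]; [exists (k + 2 * 3) |].
{ split; [lia | split; trivial; apply R; lia]. }
exfalso.
pose proof (fun t => T (k + 0 * 3) (k + 1 * 3) t ltac:(lia) ltac:(lia) ltac:(lia)) as T01.
pose proof (fun t => T (k + 0 * 3) (k + 2 * 3) t ltac:(lia) ltac:(lia) ltac:(lia)) as T02.
pose proof (fun t => T (k + 1 * 3) (k + 2 * 3) t ltac:(lia) ltac:(lia) ltac:(lia)) as T12.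
destruct D0 as [D0|D0], D1 as [D1|D1], D2 as [D2|D2]; eauto.
Qed.

(** Each connector meets the apex at some time, when 0, ..., 5 are visible as well, so [sector]
    applies. These times may differ between connectors, but the points are the same in all
    frames. *)
Lemma gadget_drawing l s e p gam g : straight_plan l s e p gam -> (g < 9) ->
  (forall t, visible s e (4 * g + 6) t -> forall v, (v < 6) -> visible s e v t) ->
  gadget_at (p 0%nat) (p 1%nat) (p 2%nat) (p (4 * g + 6))
    (p (vertex g 3)) (p (vertex g 4)) (p (vertex g 5)).
Proof.
intros P Hg V.
assert (VC : forall t, visible s e (4 * g + 6) t ->
  forall i, (i < 3) -> visible s e i t) by (intros; apply (V t); trivial; lia).
assert (VA : exists t, visible s e (4 * g + 6) t).
{ exists (s (4 * g + 6)); destruct P as [[[I _] _] _].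
  destruct (I (4 * g + 6) ltac:(lia)) as (_ & ? & _); unfold visible; lia. }
assert (S : forall i j k c h,
  (i < 3 -> j < 3 -> k < 3 -> i <> j -> j <> k -> k <> i -> 6 < c < 10 -> 3 <= h < 6 ->
  template_adj c i = true -> template_adj c j = true -> template_adj c 6 = true ->
  template_adj c h = true ->
  cone (p k) (p i) (p j) (p (4 * g + 6)) \/
  inside (p i) (p j) (p (4 * g + 6)) (p (vertex g h)))).
{ intros i j k c h Hi Hj Hk Nij Njk Nki Hc Hh Ci Cj C6 Ch.
  assert (Ei : forall i, (i < 3) -> vertex g i = i)
    by (intros i0 Hi0; unfold vertex; now rewrite (proj2 (Nat.ltb_lt _ _) Hi0)).
  assert (Ec : forall c, (6 <= c) -> vertex g c = (4 * g + c)).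
  { intros c0 Hc0; unfold vertex.
    now rewrite (proj2 (Nat.ltb_ge c0 3)), (proj2 (Nat.ltb_ge c0 6)) by lia. }
  assert (Eh : (3 <= vertex g h < 6)).
  { unfold vertex; rewrite (proj2 (Nat.ltb_ge h 3)), (proj2 (Nat.ltb_lt h 6)) by lia.
    pose proof (Nat.mod_upper_bound (h + g) 3); lia. }
  assert (Ac : adj (4 * g + c) (4 * g + 6)).
  { rewrite <- !Ec by lia; apply gadget_adj; trivial; lia. }
  assert (Et : exists t, visible s e (4 * g + c) t /\ visible s e (4 * g + 6) t)
    by now apply P.
  destruct Et as (t & Vc & Va).
  assert (Hci : adj (4 * g + c) i).
  { rewrite <- (Ei i Hi), <- Ec by lia; apply gadget_adj; trivial; lia. }
  assert (Hcj : adj (4 * g + c) j).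
  { rewrite <- (Ei j Hj), <- Ec by lia; apply gadget_adj; trivial; lia. }
  assert (Hch : adj (4 * g + c) (vertex g h)).
  { rewrite <- Ec by lia; apply gadget_adj; trivial; lia. }
  assert (F : forall u v, adj u v -> visible s e u t -> visible s e v t -> frame s e t u v)
    by (intros; split; auto).
  apply (sector (frame s e t) p i j k (4 * g + 6) (4 * g + c) (vertex g h)); try lia.
  - now apply (frame_straight l s e p gam).
  - repeat split; try (apply (VC t); trivial); now apply corners_adj.
  - split; [| split]; apply F; auto; apply apex_adj; lia.
  - split; [| split]; apply F; auto.
  - apply F; trivial; apply (V t); trivial; lia. }
split; [| split; [| split]].
- destruct VA as [t Ht]; apply (apex_signs (frame s e t) p).
  + now apply (frame_straight l s e p gam).
  + apply corner_triangle; now apply VC.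
  + apply apex_in_frame; trivial; now apply VC.
- now apply (S 1 2 0 7 3); try lia.
- now apply (S 2 0 1 8 4); try lia.
- now apply (S 0 1 2 9 5); try lia.
Qed.

Lemma no_geometric_storyplan : ~ has_planar_geometric_storyplan 42 adj.
Proof.
intros (l & s & e & p & gam & P).
change (straight_plan l s e p gam) in P.
destruct (surrounded_gadget l s e p gam 0 P ltac:(lia)) as (g0 & H0 & M0 & V0).
destruct (surrounded_gadget l s e p gam 1 P ltac:(lia)) as (g1 & H1 & M1 & V1).
destruct (surrounded_gadget l s e p gam 2 P ltac:(lia)) as (g2 & H2 & M2 & V2).
pose proof (gadget_drawing l s e p gam g0 P H0 V0) as G0.
pose proof (gadget_drawing l s e p gam g1 P H1 V1) as G1.
pose proof (gadget_drawing l s e p gam g2 P H2 V2) as G2.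
(* The order of 3, 4, 5 in a gadget depends only on [g mod 3], so the residues 0, 1, 2 yield the
   three rotations. *)
assert (E : forall g i, (3 <= i < 6) -> vertex g i = (3 + (i mod 3 + g mod 3) mod 3)).
{ intros g i Hi; unfold vertex.
  rewrite (proj2 (Nat.ltb_ge i 3)), (proj2 (Nat.ltb_lt i 6)) by lia.
  now rewrite <- Nat.Div0.add_mod. }
rewrite !E, M0 in G0 by lia; rewrite !E, M1 in G1 by lia; rewrite !E, M2 in G2 by lia.
simpl in G0, G1, G2.
refine (no_rotated_gadgets _ _ _ _ _ _ _ _ _ _ G0 G1 G2).
(* The whole triangle is visible when the apex of [g0] appears, so it is nondegenerate. *)
apply (triangle_area (frame s e (s (4 * g0 + 6))) p);
  try (now apply (frame_straight l s e p gam));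
  apply corner_triangle; intros i Hi; apply V0; try lia;
  destruct P as [[[I _] _] _]; destruct (I (4 * g0 + 6) ltac:(lia)) as (_ & ? & _);
  unfold visible; lia.
Qed.

(** * The twisted storyplan *)

Open Scope R_scope.

(** Truncation to the unit interval; absolute values make its continuity immediate. *)
Definition clamp (x : R) : R := (Rabs x - Rabs (x - 1) + 1) / 2.

Lemma clamp_0 x : x <= 0 -> clamp x = 0.
Proof. intros; unfold clamp; rewrite !Rabs_left1 by lra; lra. Qed.

Lemma clamp_1 x : 1 <= x -> clamp x = 1.
Proof. intros; unfold clamp; rewrite !Rabs_right by lra; lra. Qed.

Lemma continuity_clamp : continuity clamp.
Proof.
intros x; unfold clamp; reg; apply Rcontinuity_abs.
Qed.

(** The form of the hexagonal lattice; its rotation of order 3 maps integer points to integer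
    points. *)
Definition norm2 (P : point) : R := fst P * fst P - fst P * snd P + snd P * snd P.

(* The rotation of angle [2 * atan (m * sqrt 3)] about the origin for the quadratic form [norm2]; [m = 1] is the rotation of order 3. *)
Definition rotate (m : R) (P : point) : point :=
  (((1 - 3 * m * m) * fst P + 2 * m * (fst P - 2 * snd P)) / (1 + 3 * m * m),
   ((1 - 3 * m * m) * snd P + 2 * m * (2 * fst P - snd P)) / (1 + 3 * m * m)).

Lemma rotate_denominator (m : R) : 0 < 1 + 3 * m * m.
Proof. pose proof (Rle_0_sqr m); unfold Rsqr in *; lra. Qed.

Lemma norm2_rotate m P : norm2 (rotate m P) = norm2 P.
Proof.
pose proof (rotate_denominator m); unfold norm2, rotate; simpl; field; lra.
Qed.

Lemma rotateK m P : rotate (- m) (rotate m P) = P.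
Proof.
pose proof (rotate_denominator m); rewrite (surjective_pairing P) at 2;
unfold rotate; simpl; f_equal; field; lra.
Qed.

(** A third of a turn where [norm2] is at most 8, the identity from 9 on, and intermediate rotations
    on the annulus between. *)
Definition twist (P : point) : point := rotate (clamp (9 - norm2 P)) P.

(** [norm2] is preserved, so the image determines the rotation, which can then be undone. *)
Lemma twist_inj P Q : twist P = twist Q -> P = Q.
Proof.
unfold twist; intros E.
assert (N : norm2 P = norm2 Q).
{ rewrite <- (norm2_rotate (clamp (9 - norm2 P)) P), E; apply norm2_rotate. }
rewrite N in E; apply (f_equal (rotate (- clamp (9 - norm2 Q)))) in E.
now rewrite !rotateK in E.
Qed.

Lemma twist_fixed P : 9 <= norm2 P -> twist P = P.
Proof.
intros H; unfold twist; rewrite clamp_0 by lra.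
rewrite (surjective_pairing P) at 2; unfold rotate; f_equal; field.
Qed.

Lemma twist_center P : norm2 P <= 8 -> twist P = (- snd P, fst P - snd P).
Proof.
intros H; unfold twist; rewrite clamp_1 by lra; unfold rotate; f_equal; field.
Qed.

Lemma continuous_twist c : continuous_curve c -> continuous_curve (fun t => twist (c t)).
Proof.
intros [H1 H2].
set (n := fun t => norm2 (c t)).
assert (Cn : continuity n).
{ unfold n, norm2; intros t; specialize (H1 t); specialize (H2 t).
  apply (continuity_pt_plus (fun t => fst (c t) * fst (c t) - fst (c t) * snd (c t)));
  [apply (continuity_pt_minus (fun t => fst (c t) * fst (c t))) |];
  now apply continuity_pt_mult. }
set (m := fun t => clamp (9 - n t)).
assert (Cm : continuity m).
{ apply (continuity_comp (fun t => 9 - n t) clamp); [| apply continuity_clamp].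
  apply continuity_minus; trivial; now (apply continuity_const; intros ? ?). }
assert (Cd : continuity (fun t => 1 + 3 * m t * m t)).
{ apply (continuity_plus (fun _ => 1)); [now (apply continuity_const; intros ? ?) |].
  apply (continuity_mult (fun t => 3 * m t)); trivial.
  apply (continuity_mult (fun _ => 3)); trivial; now (apply continuity_const; intros ? ?). }
assert (Ce : continuity (fun t => 1 - 3 * m t * m t)).
{ apply (continuity_minus (fun _ => 1)); [now (apply continuity_const; intros ? ?) |].
  apply (continuity_mult (fun t => 3 * m t)); trivial.
  apply (continuity_mult (fun _ => 3)); trivial; now (apply continuity_const; intros ? ?). }
assert (Cf : continuity (fun t => 2 * m t)).
{ apply (continuity_mult (fun _ => 2)); trivial; now (apply continuity_const; intros ? ?). }
assert (C2 : forall f, continuity f -> continuity (fun t => 2 * f t)).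
{ intros f Hf; apply (continuity_mult (fun _ => 2)); trivial.
  now (apply continuity_const; intros ? ?). }
split; unfold twist, rotate; simpl; fold n;
  (apply (continuity_div _ (fun t => 1 + 3 * m t * m t)); trivial;
   [| intros t; pose proof (rotate_denominator (m t)); lra]);
  apply continuity_plus; apply continuity_mult; trivial;
  apply continuity_minus; trivial; now apply C2.
Qed.

Definition twists (g : nat) : point -> point := Nat.iter g twist.

Lemma twists_inj g P Q : twists g P = twists g Q -> P = Q.
Proof.
induction g as [|g IH]; simpl; trivial; intros E; now apply IH, twist_inj.
Qed.

Lemma twists_fixed g P : 9 <= norm2 P -> twists g P = P.
Proof.
intros H; induction g as [|g IH]; simpl; trivial.
fold (twists g P); rewrite IH; now apply twist_fixed.
Qed.

Lemma continuous_twists g c :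
  continuous_curve c -> continuous_curve (fun t => twists g (c t)).
Proof.
intros H; induction g as [|g IH]; simpl; trivial.
now apply (continuous_twist (fun t => twists g (c t))).
Qed.

Lemma continuous_straight_line P Q : continuous_curve (straight_line P Q).
Proof. split; unfold straight_line; simpl; reg. Qed.

(* The sites 3, 4, 5 lie where [twist] is the rotation of order 3, which maps 3 to 4 to 5 to 3; the sides of the triangle 0, 1, 2 lie where it is the identity. *)
Definition template_site (i : nat) : Z * Z :=
  nth i [(6,0); (0,6); (-6,-6); (-1,1); (-1,-2); (2,1); (0,0); (-3,-2); (2,-1); (1,3)]%Z
    (0,0)%Z.

Definition site (i : nat) : point :=
  (IZR (fst (template_site i)), IZR (snd (template_site i))).

(** * Planarity of the template by integer arithmetic *)

Definition areaz (i j k : nat) : Z :=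
  let (a, a') := template_site i in
  let (b, b') := template_site j in
  let (c, c') := template_site k in
  ((b - a) * (c' - a') - (b' - a') * (c - a))%Z.

Lemma area_site i j k : area (site i) (site j) (site k) = IZR (areaz i j k).
Proof.
unfold area, areaz, site; destruct (template_site i), (template_site j),
  (template_site k); simpl.
now rewrite minus_IZR, !mult_IZR, !minus_IZR.
Qed.

Lemma area_line P Q S T r :
  area P Q (straight_line S T r) = (1 - r) * area P Q S + r * area P Q T.
Proof. unfold area, straight_line; simpl; ring. Qed.

Lemma area_line_self P Q r : area P Q (straight_line P Q r) = 0.
Proof. unfold area, straight_line; simpl; ring. Qed.

Lemma straight_line_0 P Q : straight_line P Q 0 = P.
Proof. destruct P; unfold straight_line; simpl; f_equal; ring. Qed.

Lemma straight_line_1 P Q : straight_line P Q 1 = Q.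
Proof. destruct Q; unfold straight_line; simpl; f_equal; ring. Qed.

Lemma straight_line_inj P Q r r' :
  P <> Q -> straight_line P Q r = straight_line P Q r' -> r = r'.
Proof.
destruct P as [a a'], Q as [b b']; unfold straight_line; simpl; intros N E.
injection E; intros E2 E1; destruct (Req_dec r r') as [|M]; trivial.
exfalso; apply N; f_equal; apply (Rmult_eq_reg_l (r - r')); lra.
Qed.

(** A certificate that two edges meet at most in a common end: [k] and [m] are strictly on one side
    of the line [i j], or [i] and [j] of the line [k m], or one of [k], [m] is an end of [i j] and
    the other is off its line. *)
Definition template_ok (i j k m : nat) : bool :=
  let A := areaz i j k in let B := areaz i j m in
  let C := areaz k m i in let D := areaz k m j in
  ((0 <? A * B)%Z || (0 <? C * D)%Z ||
   ((A =? 0)%Z && negb (B =? 0)%Z && ((k =? i) || (k =? j))%nat) ||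
   ((B =? 0)%Z && negb (A =? 0)%Z && ((m =? i) || (m =? j))%nat)).

Lemma same_side P Q S T r :
  0 < area P Q S * area P Q T -> in01 r -> area P Q (straight_line S T r) <> 0.
Proof.
assert (W : forall a b, 0 < a -> 0 < b -> in01 r -> 0 < (1 - r) * a + r * b).
{ intros a b Ha Hb [H0 H1]; destruct (Rlt_le_dec r (1 / 2)).
  - apply Rplus_lt_le_0_compat; [apply Rmult_lt_0_compat | apply Rmult_le_pos]; lra.
  - apply Rplus_le_lt_0_compat; [apply Rmult_le_pos | apply Rmult_lt_0_compat]; lra. }
rewrite area_line; set (a := area P Q S); set (b := area P Q T); intros H Hr E.
destruct (Rlt_le_dec 0 a) as [A|A].
- assert (B : 0 < b) by nra; pose proof (W a b A B Hr); lra.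
- destruct A as [A|A]; [| rewrite A in H; lra].
  assert (b < 0) by nra.
  pose proof (W (- a) (- b) ltac:(lra) ltac:(lra) Hr); lra.
Qed.

Lemma template_ok_correct i j k m r r' : template_ok i j k m = true ->
  in01 r -> in01 r' ->
  straight_line (site i) (site j) r = straight_line (site k) (site m) r' ->
  exists z, (z = i \/ z = j) /\ (z = k \/ z = m) /\
    straight_line (site i) (site j) r = site z.
Proof.
intros H Hr Hr' E.
assert (L : area (site i) (site j) (straight_line (site k) (site m) r') = 0).
{ rewrite <- E; apply area_line_self. }
assert (L' : area (site k) (site m) (straight_line (site i) (site j) r) = 0).
{ rewrite E; apply area_line_self. }
unfold template_ok in H; rewrite !orb_true_iff, !andb_true_iff, !negb_true_iff,
  !orb_true_iff, !Nat.eqb_eq, !Z.eqb_eq, !Z.eqb_neq, !Z.ltb_lt in H.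
destruct H as [[[H|H]|H]|H].
- exfalso; revert L; apply same_side; trivial.
  rewrite !area_site, <- mult_IZR; now apply IZR_lt.
- exfalso; revert L'; apply same_side; trivial.
  rewrite !area_site, <- mult_IZR; now apply IZR_lt.
- destruct H as [[HA HB] HK].
  exists k; split; [tauto | split; [tauto |]].
  rewrite area_line, !area_site, HA in L; apply not_0_IZR in HB.
  (* Along [k m] the area is [r'] times its nonzero value at [m], so it vanishes only at [k]. *)
  assert (R0 : r' = 0) by (apply (Rmult_eq_reg_r (IZR (areaz i j m))); trivial; lra).
  rewrite E, R0; apply straight_line_0.
- destruct H as [[HB HA] HM].
  exists m; split; [tauto | split; [tauto |]].
  rewrite area_line, !area_site, HB in L; apply not_0_IZR in HA.
  assert (R0 : 1 - r' = 0) by (apply (Rmult_eq_reg_r (IZR (areaz i j k))); trivial; lra).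
  rewrite E; replace r' with 1 by lra; apply straight_line_1.
Qed.

Definition template_pairs : list (nat * nat) :=
  filter (fun e => template_adj (fst e) (snd e)) (list_prod (seq 0 10) (seq 0 10)).

Lemma in_template_pairs i j : (i < 10)%nat -> (j < 10)%nat -> template_adj i j = true ->
  In (i, j) template_pairs.
Proof.
intros Hi Hj H; apply filter_In; split; trivial.
apply in_prod; apply in_seq; lia.
Qed.

Lemma template_planar i j k m r r' :
  (i < 10)%nat -> (j < 10)%nat -> (k < 10)%nat -> (m < 10)%nat ->
  template_adj i j = true -> template_adj k m = true ->
  ~ ((i = k /\ j = m) \/ (i = m /\ j = k)) -> in01 r -> in01 r' ->
  straight_line (site i) (site j) r = straight_line (site k) (site m) r' ->
  exists z, (z = i \/ z = j) /\ (z = k \/ z = m) /\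
    straight_line (site i) (site j) r = site z.
Proof.
assert (H : forallb (fun e => forallb (fun f =>
    ((fst e =? fst f) && (snd e =? snd f) || (fst e =? snd f) && (snd e =? fst f))%nat ||
    template_ok (fst e) (snd e) (fst f) (snd f)) template_pairs) template_pairs = true)
  by (vm_compute; trivial).
intros Hi Hj Hk Hm Hij Hkm N; apply template_ok_correct.
rewrite forallb_forall in H; specialize (H _ (in_template_pairs i j Hi Hj Hij)).
rewrite forallb_forall in H; specialize (H _ (in_template_pairs k m Hk Hm Hkm)).
simpl in H; rewrite !orb_true_iff, !andb_true_iff, !Nat.eqb_eq in H; tauto.
Qed.

Lemma template_off i j k :
  (i < 10)%nat -> (j < 10)%nat -> (k < 10)%nat ->
  template_adj i j = true -> k <> i -> k <> j -> off_segment (site i) (site j) (site k).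
Proof.
assert (H : forallb (fun e => forallb (fun k =>
    (k =? fst e)%nat || (k =? snd e)%nat || negb (areaz (fst e) (snd e) k =? 0)%Z)
    (seq 0 10)) template_pairs = true)
  by (vm_compute; trivial).
intros Hi Hj Hk Hij Ni Nj r _ E.
rewrite forallb_forall in H; specialize (H _ (in_template_pairs i j Hi Hj Hij)).
apply (forallb_lt _ _) with (k := k) in H; trivial; simpl in H.
rewrite !orb_true_iff, !Nat.eqb_eq, negb_true_iff, Z.eqb_neq in H.
destruct H as [[H|H]|H]; try tauto.
apply not_0_IZR in H; apply H; rewrite <- area_site, <- E; apply area_line_self.
Qed.

Lemma site_inj i j : (i < 10)%nat -> (j < 10)%nat -> site i = site j -> i = j.
Proof.
assert (H : forallb (fun i => forallb (fun j => (i =? j)%nat ||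
    negb ((fst (template_site i) =? fst (template_site j))%Z &&
          (snd (template_site i) =? snd (template_site j))%Z))
    (seq 0 10)) (seq 0 10) = true)
  by (vm_compute; trivial).
intros Hi Hj E; injection E; intros E2 E1; apply eq_IZR in E1, E2.
apply (forallb_lt _ _ H) in Hi; apply (forallb_lt _ _ Hi) in Hj.
rewrite E1, E2, !Z.eqb_refl, orb_false_r in Hj; now apply Nat.eqb_eq.
Qed.

Lemma corner_edge_fixed i j r g : (i < 3)%nat -> (j < 3)%nat -> i <> j -> 
  twists g (straight_line (site i) (site j) r) = straight_line (site i) (site j) r.
Proof.
intros Hi Hj N; apply twists_fixed.
(* On a side, [norm2] equals [9 + 27 (2 r - 1)^2]; its minimum, at the midpoint, is exactly the
   bound from which the twist is the identity. *)
assert (S : 0 <= (2 * r - 1) * (2 * r - 1)) by apply Rle_0_sqr.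
destruct i as [|[|[|i]]]; try lia; destruct j as [|[|[|j]]]; try lia;
  unfold norm2, straight_line, site; simpl; lra.
Qed.

Lemma twists_corner i g : (i < 3)%nat -> twists g (site i) = site i.
Proof.
intros Hi; apply twists_fixed; destruct i as [|[|[|i]]]; try lia;
  unfold norm2, site; simpl; lra.
Qed.

(** The shift agrees with that in [vertex], so all gadgets put 3, 4, 5 at the same places. *)
Lemma twists_persistent i g : (3 <= i < 6)%nat ->
  twists g (site i) = site (3 + (i + g) mod 3).
Proof.
intros Hi; induction g as [|g IH].
- destruct i as [|[|[|[|[|[|i]]]]]]; try lia; trivial.
- change (twists (S g) (site i)) with (twist (twists g (site i))); rewrite IH.
  replace (i + S g)%nat with (1 + (i + g))%nat by lia.
  rewrite (Nat.Div0.add_mod 1).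
  pose proof (Nat.mod_upper_bound (i + g) 3 ltac:(lia)) as B; revert B.
  generalize ((i + g) mod 3)%nat; intros k Hk.
  destruct k as [|[|[|k]]]; try lia; rewrite twist_center;
    unfold norm2, site; simpl; try lra; f_equal; lra.
Qed.

(** * The storyplan that shows one gadget at a time *)

(** Truncated subtraction gives 0 on the shared vertices 0, ..., 5. *)
Definition gadget_of (v : nat) : nat := ((v - 6) / 4)%nat.

(** The inverse of [vertex g]; [2 * g] stands for [- g] modulo 3. *)
Definition template_index (g v : nat) : nat :=
  (if v <? 3 then v else if v <? 6 then 3 + (v + 2 * g) mod 3 else v - 4 * g)%nat.

Definition position (v : nat) : point :=
  twists (gadget_of v) (site (template_index (gadget_of v) v)).

(** As [gadget_of] is 0 on shared vertices, the maximum is the gadget of the edge; a side of the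
    triangle, common to all gadgets, gets 0. *)
Definition edge_curve (u v : nat) : curve :=
  let g := Nat.max (gadget_of u) (gadget_of v) in
  fun r => twists g (straight_line (site (template_index g u)) (site (template_index g v)) r).

Lemma position_vertex g i : (g < 9)%nat -> (i < 10)%nat ->
  position (vertex g i) = twists g (site i).
Proof.
intros Hg Hi.
destruct (le_lt_dec 6 i) as [L|L]; [| destruct (le_lt_dec 3 i) as [L'|L']].
- assert (H : forallb (fun g => forallb (fun i => (i <? 6) ||
    (gadget_of (vertex g i) =? g) && (template_index g (vertex g i) =? i))%nat
    (seq 0 10)) (seq 0 9) = true) by (vm_compute; trivial).
  apply (forallb_lt _ _) with (k := g) in H; trivial.
  apply (forallb_lt _ _) with (k := i) in H; trivial.
  rewrite (proj2 (Nat.ltb_ge i 6) L), orb_false_l, andb_true_iff, !Nat.eqb_eq in H.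
  destruct H as [H1 H2]; unfold position; now rewrite H1, H2.
- rewrite twists_persistent by lia; unfold vertex.
  rewrite (proj2 (Nat.ltb_ge i 3)), (proj2 (Nat.ltb_lt i 6)) by lia.
  pose proof (Nat.mod_upper_bound (i + g) 3 ltac:(lia)) as B; revert B.
  generalize ((i + g) mod 3)%nat; intros k Hk.
  destruct k as [|[|[|k]]]; try lia; trivial.
- rewrite twists_corner by lia; unfold vertex.
  rewrite (proj2 (Nat.ltb_lt i 3)) by lia.
  destruct i as [|[|[|i]]]; try lia; trivial.
Qed.

Lemma edge_curve_vertex g i j r : (g < 9)%nat -> (i < 10)%nat -> (j < 10)%nat ->
  template_adj i j = true ->
  edge_curve (vertex g i) (vertex g j) r = twists g (straight_line (site i) (site j) r).
Proof.
intros Hg Hi Hj Hij.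
assert (H : forallb (fun g => forallb (fun i => forallb (fun j =>
    negb (template_adj i j) ||
    (i <? 3) && (j <? 3) && negb (i =? j) ||
    let h := Nat.max (gadget_of (vertex g i)) (gadget_of (vertex g j)) in
    (h =? g) && (template_index g (vertex g i) =? i) &&
      (template_index g (vertex g j) =? j))%nat
    (seq 0 10)) (seq 0 10)) (seq 0 9) = true) by (vm_compute; trivial).
apply (forallb_lt _ _) with (k := g) in H; trivial.
apply (forallb_lt _ _) with (k := i) in H; trivial.
apply (forallb_lt _ _) with (k := j) in H; trivial.
rewrite Hij in H; simpl negb in H; cbv zeta in H.
rewrite orb_false_l, orb_true_iff, !andb_true_iff, negb_true_iff, !Nat.ltb_lt,
  !Nat.eqb_eq, Nat.eqb_neq in H.
destruct H as [[[H1 H2] H3]|[[H1 H2] H3]].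
(* Sides of the triangle are drawn untwisted, which agrees with every gadget because the twists fix
   them pointwise. *)
- rewrite corner_edge_fixed by trivial.
  unfold vertex; rewrite (proj2 (Nat.ltb_lt i 3)), (proj2 (Nat.ltb_lt j 3)) by trivial.
  destruct i as [|[|[|i]]]; try lia; destruct j as [|[|[|j]]]; try lia; trivial.
- unfold edge_curve; now rewrite H1, H2, H3.
Qed.

(** Time steps start at 1, so gadget [g] is shown at [S g]. *)
Definition first_time (v : nat) : nat := if (v <? 6)%nat then 1%nat else S (gadget_of v).
Definition last_time (v : nat) : nat := if (v <? 6)%nat then 9%nat else S (gadget_of v).

Lemma visible_vertex g i : (g < 9)%nat -> (i < 10)%nat ->
  visible first_time last_time (vertex g i) (S g).
Proof.
assert (H : forallb (fun g => forallb (fun i =>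
    (first_time (vertex g i) <=? S g) && (S g <=? last_time (vertex g i)))%nat
    (seq 0 10)) (seq 0 9) = true) by (vm_compute; trivial).
intros Hg Hi; apply (forallb_lt _ _ H) in Hg; apply (forallb_lt _ _ Hg) in Hi.
now rewrite andb_true_iff, !Nat.leb_le in Hi.
Qed.

Lemma visible_vertexP g v : (g < 9)%nat -> (v < 42)%nat ->
  visible first_time last_time v (S g) -> exists i, (i < 10)%nat /\ v = vertex g i.
Proof.
assert (H : forallb (fun g => forallb (fun v =>
    negb ((first_time v <=? S g) && (S g <=? last_time v))%nat ||
    existsb (fun i => v =? vertex g i)%nat (seq 0 10))
    (seq 0 42)) (seq 0 9) = true) by (vm_compute; trivial).
intros Hg Hv [V1 V2]; apply (forallb_lt _ _ H) in Hg; apply (forallb_lt _ _ Hg) in Hv.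
apply Nat.leb_le in V1, V2; rewrite V1, V2, orb_false_l, existsb_exists in Hv.
destruct Hv as (i & Hi & E); apply in_seq in Hi; apply Nat.eqb_eq in E.
exists i; split; trivial; lia.
Qed.

(** Frames are induced subgraphs, but other gadgets add no edge: the only edges among shared
    vertices are the sides of the triangle. *)
Lemma adj_vertex g i j : (g < 9)%nat -> (i < 10)%nat -> (j < 10)%nat ->
  adj (vertex g i) (vertex g j) -> template_adj i j = true.
Proof.
assert (H : forallb (fun g => forallb (fun i => forallb (fun j =>
    template_adj i j || negb (adjb (vertex g i) (vertex g j)))
    (seq 0 10)) (seq 0 10)) (seq 0 9) = true) by (vm_compute; trivial).
intros Hg Hi Hj E; apply (forallb_lt _ _ H) in Hg; apply (forallb_lt _ _ Hg) in Hi.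
apply (forallb_lt _ _ Hi) in Hj; unfold adj in E.
now rewrite E, orb_false_r in Hj.
Qed.

(** The frame at [S g] is the image of the straight-line template under the injective map
    [twists g], which carries over all three conditions of planarity. *)
Lemma topological_storyplan : has_planar_storyplan 42 adj.
Proof.
exists 9%nat, first_time, last_time, position, edge_curve; split; [split | split].
- assert (H : forallb (fun v => (1 <=? first_time v) && (first_time v <=? last_time v) &&
    (last_time v <=? 9))%nat (seq 0 42) = true) by (vm_compute; trivial).
  intros v Hv; apply (forallb_lt _ _ H) in Hv.
  rewrite !andb_true_iff, !Nat.leb_le in Hv; tauto.
- intros u v; rewrite adjP; intros (g & i & j & Hg & Hi & Hj & -> & -> & _).
  exists (S g); split; now apply visible_vertex.
- intros u v A; generalize A; rewrite adjP.
  intros (g & i & j & Hg & Hi & Hj & -> & -> & H).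
  split; [apply (continuous_twists _ _), continuous_straight_line |].
  rewrite !edge_curve_vertex, !position_vertex, straight_line_0, straight_line_1 by trivial.
  split; [| split; [| split]]; trivial.
  + intros r r' _ _; rewrite !edge_curve_vertex by trivial; intros E.
    apply twists_inj, straight_line_inj in E; trivial.
    intros E'; apply site_inj in E'; trivial.
    subst; now apply (adj_irrefl (vertex g j)).
  + intros r _; rewrite !edge_curve_vertex by (trivial; now rewrite template_adj_sym).
    f_equal; apply straight_line_rev.
- intros t Ht; destruct t as [|g]; [lia |].
  assert (Hg : (g < 9)%nat) by lia; clear Ht.
  split; [| split].
  + intros u v [Hu Vu] [Hv Vv] N E.
    destruct (visible_vertexP g u Hg Hu Vu) as (i & Hi & ->).
    destruct (visible_vertexP g v Hg Hv Vv) as (j & Hj & ->).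
    rewrite !position_vertex in E by trivial; apply twists_inj, site_inj in E; congruence.
  + intros u v w w' A [Hu Vu] [Hv Vv] [Hw Vw] Nu Nv Hr E.
    destruct (visible_vertexP g u Hg Hu Vu) as (i & Hi & ->).
    destruct (visible_vertexP g v Hg Hv Vv) as (j & Hj & ->).
    destruct (visible_vertexP g w Hg Hw Vw) as (k & Hk & ->).
    apply adj_vertex in A; trivial.
    rewrite edge_curve_vertex, position_vertex in E by trivial; apply twists_inj in E.
    revert E; apply template_off; trivial; congruence.
  + intros u v x y r r' A B [Hu Vu] [Hv Vv] [Hx Vx] [Hy Vy] N Hr Hr' E.
    destruct (visible_vertexP g u Hg Hu Vu) as (i & Hi & ->).
    destruct (visible_vertexP g v Hg Hv Vv) as (j & Hj & ->).
    destruct (visible_vertexP g x Hg Hx Vx) as (k & Hk & ->).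
    destruct (visible_vertexP g y Hg Hy Vy) as (m & Hm & ->).
    apply adj_vertex in A; trivial; apply adj_vertex in B; trivial.
    rewrite !edge_curve_vertex in E by trivial; apply twists_inj in E.
    destruct (template_planar i j k m r r') as (z & Z1 & Z2 & Z3); trivial.
    { intros [[-> ->]|[-> ->]]; tauto. }
    assert (Hz : (z < 10)%nat) by (destruct Z1; subst; trivial).
    exists (vertex g z); split; [destruct Z1; subst; tauto |].
    split; [destruct Z2; subst; tauto |].
    now rewrite edge_curve_vertex, position_vertex, Z3.
Qed.

Theorem theorem1 :
  exists (n : nat) (adj : nat -> nat -> Prop),
    simple_graph n adj /\
    has_planar_storyplan n adj /\
    ~ has_planar_geometric_storyplan n adj.
Proof.
exists 42%nat, adj; split; [| split].
- apply adj_simple.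
- apply topological_storyplan.
- apply no_geometric_storyplan.
Qed.
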